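(* Let $A$ be a real finite-dimensional affine space. If $m\in\mathrm{Met}(A)$ is a non-degenerate metric on $A$, then $\mathrm{CM}_m$ is a non-degenerate symmetric bilinear form on $\mathrm{Aff}(\mathrm{Quad}_mA)$.
   Context: All spaces are real and finite-dimensional. For an affine space $A$ with director vector space $\vec A$: $\mathrm{Aff}(A)$ is the vector space of affine functions $A\to\mathbb R$, $u$ the constant function $1$. The linear hull is $\widehat A=(\mathrm{Aff}(A))^*$; $z_P\in\widehat A$ is evaluation at $P$; $A$ is identified with $\{z:\langle z,u\rangle=1\}$ and $\vec A$ with $\{z:\langle z,u\rangle=0\}$, $\overrightarrow{PQ}=z_Q-z_P$. A function $\delta:A\to\mathbb R$ is quadratic if $\delta(\alpha P+\beta Q)=\alpha(\alpha-\beta)\delta(P)+\beta(\beta-\alpha)\delta(Q)+4\alpha\beta\,\delta(\frac{P+Q}2)$ whenever $\alpha+\beta=1$; $\mathrm{Quad}(A)$ is the vector space of these. Each $\delta\in\mathrm{Quad}(A)$ has a symmetric bilinear form $\mathrm{Hess}\,\delta$ on $\vec A$ (hessian principal component), characterized by $\frac12(\delta(Q)+\delta(2P-Q))-\delta(P)=\frac12\mathrm{Hess}\,\delta(\overrightarrow{PQ},\overrightarrow{PQ})$. $\mathrm{Met}(A)=\mathrm{Quad}(A)/\mathrm{Aff}(A)$ is the space of metrics; for $m\in\mathrm{Met}(A)$, $\mathrm{Quad}_mA\subset\mathrm{Quad}(A)$ is the class $m$, an affine space with director space $\mathrm{Aff}(A)$; its elements share the same hessian principal component $g$ (that of $m$).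 $m$ is non-degenerate if $g$ has trivial nullspace. $\delta^m_P\in\mathrm{Quad}_mA$ is $\delta^m_P(Q)=\frac12g(\overrightarrow{PQ},\overrightarrow{PQ})$. $\mathrm{Aff}(\mathrm{Quad}_mA)$ is the vector space of affine functionals $\mathrm{Quad}_mA\to\mathbb R$; its dual is $\widehat{\mathrm{Quad}_mA}$, in which $\mathrm{Quad}_mA$ is embedded by evaluation. $v_P(\delta)=\delta(P)$ for $P\in A$. $\mathrm d_m:\mathrm{Aff}(\mathrm{Quad}_mA)\to\widehat A$, $\langle\mathrm d_m\bar v,s\rangle=\bar v(\delta+s)-\bar v(\delta)$, $s\in\mathrm{Aff}(A)$ (any $\delta\in\mathrm{Quad}_mA$). $\mathrm{Aff}_0(\mathrm{Quad}_mA)$ is the subspace of $\bar v$ with $\bar v(\delta+\alpha u)=\bar v(\delta)$ for all $\delta,\alpha$; $\mathrm d_m$ maps it into $\vec A$. The Cayley–Menger form $\mathrm{CM}_m$ is the unique symmetric bilinear form on $\mathrm{Aff}(\mathrm{Quad}_mA)$ with (1) $\mathrm{CM}_m(v_1,v_2)=-g(\mathrm d_mv_1,\mathrm d_mv_2)$ for $v_1,v_2\in\mathrm{Aff}_0(\mathrm{Quad}_mA)$ and (2) $\mathrm{CM}_m(v_P,\cdot)=\delta^m_P$ in $\widehat{\mathrm{Quad}_mA}$ for all $P\in A$ (for $m\ne0$, (2) may equivalently be replaced by $\mathrm{CM}_m(v_P,v_P)=0$ for all $P\in A$). *)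

(* Defs.v *)
From HB Require Import structures.
From mathcomp Require Import all_boot all_order all_algebra.
From mathcomp Require Import sesquilinear ring_quotient generic_quotient.
From mathcomp Require Import boolp functions reals.
From mathcomp Require Import ring lra.

Set Implicit Arguments.
Unset Strict Implicit.
Unset Printing Implicit Defensive.

Import Order.TTheory GRing.Theory Num.Theory.
Local Open Scope ring_scope.

HB.mixin Record isAffine (R : realType) (V : vectType R) (A : Type) := {
  translate : A -> V -> A;
  vect : A -> A -> V;
  translateK : forall P x, vect P (translate P x) = x;
  vectK : forall P Q, translate P (vect P Q) = Q;
  translateA : forall P x y, translate (translate P x) y = translate P (x + y);
  affine_inhabited : inhabited A
}.

#[short(type="affineType")]
HB.structure Definition Affine (R : realType) (V : vectType R) :=
  {A of isAffine R V A}.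

Notation "P +v x" := (translate P x) (at level 50, left associativity).

Section AffineBasics.
Context {R : realType} {V : vectType R} {A : affineType V}.
Implicit Types (P Q S : A) (x y : V).

Lemma translate0 P : P +v 0 = P.
Proof.
have H : vect P P + vect P P = vect P P.
  by rewrite -[LHS](translateK P) -translateA !vectK.
by rewrite -{2}(vectK P P); congr (_ +v _); apply: (addrI (vect P P));
  rewrite addr0 H.
Qed.

Lemma translateI P : injective (translate P).
Proof. by move=> x y /(congr1 (vect P)); rewrite !translateK. Qed.

Lemma vectD P Q S : vect P Q + vect Q S = vect P S.
Proof. by apply: (@translateI P); rewrite -translateA !vectK. Qed.

Lemma vectN P Q : - vect P Q = vect Q P.
Proof.
apply/eqP; rewrite eq_sym -addr_eq0 vectD; apply/eqP.
by apply: (@translateI Q); rewrite vectK translate0.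
Qed.

Lemma vectB P Q S : vect P Q - vect P S = vect S Q.
Proof. by rewrite vectN addrC vectD. Qed.

Definition origin : A :=
  let: exist P _ := cid (let: inhabits P := affine_inhabited in
                         ex_intro (fun _ : A => True) P I) in P.

(* a P + b Q, meaningful only when a + b = 1 (see combC); a is then redundant. *)
Definition comb (a b : R) P Q : A := P +v (b *: vect P Q).

Lemma combC a b P Q : a + b = 1 -> comb a b P Q = comb b a Q P.
Proof.
move=> ab; rewrite /comb -{2}(vectK P Q) translateA; congr (_ +v _).
have -> : b = 1 - a by rewrite -ab addrC addKr.
by rewrite -(vectN P Q) scalerN scalerBl scale1r.
Qed.

End AffineBasics.

Section AffineFunctions.
Context {R : realType} {V : vectType R}.
Variable A : affineType V.

Definition is_affine (f : A -> R^o) : Prop :=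
  forall (a b : R) (P Q : A), a + b = 1 ->
    f (comb a b P Q) = a * f P + b * f Q.

Definition affine_pred : {pred A -> R^o} := fun f => `[< is_affine f >].

Lemma affine_predP f : reflect (is_affine f) (f \in affine_pred).
Proof. exact: asboolP. Qed.

Lemma affine_submod_closed : submod_closed affine_pred.
Proof.
split; first by apply/affine_predP => a b P Q _; rewrite !mulr0 addr0.
move=> c f g /affine_predP Hf /affine_predP Hg; apply/affine_predP.
move=> a b P Q ab; rewrite addrfctE scalrfctE (Hf _ _ _ _ ab) (Hg _ _ _ _ ab).
by rewrite /GRing.scale /=; ring.
Qed.

HB.instance Definition _ :=
  GRing.isSubmodClosed.Build R (A -> R^o) affine_pred affine_submod_closed.

Record Aff := MkAff { aff_fun :> A -> R^o; aff_funP : aff_fun \in affine_pred }.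

HB.instance Definition _ := [isSub for aff_fun].
HB.instance Definition _ := [Choice of Aff by <:].
HB.instance Definition _ := [SubChoice_isSubLmodule of Aff by <:].

Lemma AffE (f : Aff) : is_affine f.
Proof. exact/affine_predP/aff_funP. Qed.

Lemma AffP (f g : Aff) : f =1 g -> f = g.
Proof. by move=> fg; apply/val_inj/funext. Qed.

End AffineFunctions.

Section LinearPart.
Context {R : realType} {V : vectType R} {A : affineType V}.

Lemma comb_translate a b (P : A) x y : a + b = 1 ->
  comb a b (P +v x) (P +v y) = P +v (a *: x + b *: y).
Proof.
move=> ab; rewrite /comb translateA; congr (_ +v _).
have -> : vect (P +v x) (P +v y) = y - x.
  by rewrite -(vectB P) !translateK.
have -> : a = 1 - b by rewrite -ab addrK.
by rewrite scalerBr scalerBl scale1r addrAC addrA.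
Qed.

Lemma affine_translateD (f : A -> R^o) (P : A) x y : is_affine f ->
  f (P +v (x + y)) = f (P +v x) + f (P +v y) - f P.
Proof.
move=> Hf.
have h1 : 2^-1 + 2^-1 = 1 :> R by field.
have h2 : (-1) + 2 = 1 :> R by ring.
have E1 := Hf _ _ (P +v x) (P +v y) h1.
rewrite comb_translate // in E1.
have E2 := Hf _ _ (P +v 0) (P +v (2^-1 *: x + 2^-1 *: y)) h2.
rewrite comb_translate // E1 translate0 scaler0 add0r in E2.
rewrite scalerDr !scalerA mulfV ?pnatr_eq0 // !scale1r in E2.
by rewrite E2; field.
Qed.

Lemma affine_translateZ (f : A -> R^o) (P : A) c x : is_affine f ->
  f (P +v (c *: x)) = (1 - c) * f P + c * f (P +v x).
Proof.
move=> Hf; rewrite -Hf ?subrK // -{2}(translate0 P) comb_translate ?subrK //.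
by rewrite scaler0 add0r.
Qed.

Definition lin_fun (f : Aff A) (x : V) : R^o := f (origin +v x) - f origin.

Lemma lin_funE (f : Aff A) P x : lin_fun f x = f (P +v x) - f P.
Proof.
have := affine_translateD origin (vect origin P) x (AffE f).
by rewrite -translateA vectK /lin_fun => ->; ring.
Qed.

Lemma lin_fun_is_linear f : linear (lin_fun f).
Proof.
move=> c x y; rewrite /lin_fun (affine_translateD _ _ _ (AffE f)).
by rewrite (affine_translateZ _ _ _ (AffE f)) /GRing.scale /=; ring.
Qed.
HB.instance Definition _ (f : Aff A) :=
  GRing.isLinear.Build R V R^o _ (lin_fun f) (lin_fun_is_linear f).

Definition linpart (f : Aff A) : 'Hom(V, R^o) := linfun (lin_fun f).

Lemma linpartE (f : Aff A) P x : linpart f x = f (P +v x) - f P.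
Proof. by rewrite lfunE -lin_funE. Qed.

Lemma addAffE (f g : Aff A) P : (f + g) P = f P + g P.
Proof. by []. Qed.
Lemma oppAffE (f : Aff A) P : (- f) P = - f P.
Proof. by []. Qed.
Lemma subAffE (f g : Aff A) P : (f - g) P = f P - g P.
Proof. by []. Qed.
Lemma scaleAffE c (f : Aff A) P : (c *: f) P = c * f P.
Proof. by []. Qed.

Lemma lin_is_affine (u : {linear V -> R^o}) (c : R) (P : A) :
  is_affine (fun Q => u (vect P Q) + c).
Proof.
move=> a b Q S ab; have -> : vect P (comb a b Q S) = a *: vect P Q + b *: vect P S.
  by rewrite -[in LHS](vectK P Q) -[in LHS](vectK P S) comb_translate // translateK.
rewrite linearD !linearZ /= /GRing.scale /= -[X in _ + X]mul1r -ab.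
by rewrite mulrDl !mulrDr addrACA.
Qed.

Definition mkaff (u : {linear V -> R^o}) (c : R) (P : A) : Aff A :=
  MkAff (introT (affine_predP _) (lin_is_affine u c P)).

Let n := \dim (fullv : {vspace V}).
Let e : n.-tuple V := vbasis fullv.

Let coord_full x : x = \sum_(i < n) coord e i x *: e`_i.
Proof. exact: (coord_vbasis (memvf x)). Qed.

Definition aff_row (f : Aff A) : 'rV[R]_(1 + \dim (fullv : {vspace V})) :=
  row_mx (const_mx (f origin)) (\row_(i < n) lin_fun f e`_i).

Lemma aff_row_linear : linear aff_row.
Proof.
move=> c f g; apply/rowP => i; rewrite !mxE.
case: splitP => j _; rewrite !mxE // /lin_fun !addAffE !scaleAffE; ring.
Qed.

Let row_lin (r : 'rV[R]_(1 + n)) (x : V) : R^o :=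
  \sum_(i < n) coord e i x * rsubmx r 0 i.

Let row_lin_is_linear r : linear (row_lin r).
Proof.
move=> c x y; rewrite /row_lin scaler_sumr -big_split /=.
by apply: eq_bigr => i _; rewrite linearP /GRing.scale /=; ring.
Qed.
HB.instance Definition _ r :=
  GRing.isLinear.Build R V R^o _ (row_lin r) (row_lin_is_linear r).

Lemma aff_row_bij : bijective aff_row.
Proof.
exists (fun r => mkaff (row_lin r) (lsubmx r 0 0) origin) => [f|r].
  apply: AffP => Q /=; rewrite /aff_row /row_lin row_mxKl row_mxKr !mxE.
  rewrite -[in RHS](vectK origin Q).
  have -> : f (origin +v vect origin Q) = lin_fun f (vect origin Q) + f origin.
    by rewrite /lin_fun subrK.
  congr (_ + _); rewrite {2}(coord_full (vect origin Q)) linear_sum.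
  by apply: eq_bigr => i _; rewrite linearZ mxE.
have vv : vect (origin : A) origin = 0.
  by apply: (@translateI _ _ A origin); rewrite vectK translate0.
apply/rowP => k; rewrite mxE; case: splitP => j kj.
  rewrite !mxE /= vv linear0 add0r; congr (r _ _).
  by apply: val_inj; rewrite /= kj (ord1 j).
rewrite mxE (lin_funE _ origin) /= vv !translateK linear0 add0r addrK.
have -> : r 0 k = rsubmx r 0 j by rewrite mxE; congr (r _ _); apply: val_inj.
rewrite /row_lin (bigD1 j) //= big1 ?addr0 => [|i ij].
  by rewrite (coord_free _ _ (basis_free (vbasisP fullv))) eqxx mul1r.
rewrite (coord_free _ _ (basis_free (vbasisP fullv))).
by rewrite eq_sym (negbTE ij) mul0r.
Qed.

HB.instance Definition _ := Lmodule_hasFinDim.Build R (Aff A)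
  (exist2 _ _ aff_row aff_row_linear aff_row_bij).

End LinearPart.

Section Nondegenerate.
Context {R : realType} {V : vectType R}.

Lemma nondegenerateP (g : {symmetric V}) :
  nondegenerate g <-> forall x, (forall y, g x y = 0) -> x = 0.
Proof.
split=> [/eqP g0 x xg|H].
  by apply/eqP; rewrite -memv0 -g0; apply/mem_orthovP => y _; exact: xg.
apply/eqP/vspaceP => x; rewrite memv0; apply/mem_orthovP/eqP => [h|-> y _].
  by apply: H => y; apply: h; exact: memvf.
exact: linear0l.
Qed.

End Nondegenerate.

Section SymmetricForms.
Context {R : realType} {V : lmodType R}.
Variable g : {symmetric V}.

Lemma sfC x y : g x y = g y x.
Proof. by rewrite hermC mul1r. Qed.
Lemma sfDr x y z : g x (y + z) = g x y + g x z.
Proof. exact: linearDr. Qed.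
Lemma sfDl x y z : g (y + z) x = g y x + g z x.
Proof. exact: linearDl. Qed.
Lemma sfZr x c y : g x (c *: y) = c * g x y.
Proof. exact: linearZr. Qed.
Lemma sfZl x c y : g (c *: y) x = c * g y x.
Proof. exact: linearZl. Qed.
Lemma sfNr x y : g x (- y) = - g x y.
Proof. exact: linearNr. Qed.
Lemma sf0l x : g 0 x = 0.
Proof. exact: linear0l. Qed.

End SymmetricForms.

Section GluedForm.
Context {R : realType} {V U : lmodType R}.
Variables (g : {symmetric V}) (f : U -> V) (l r : U -> R).
Hypothesis fP : forall c u v, f (c *: u + v) = c *: f u + f v.
Hypothesis lP : forall c u v, l (c *: u + v) = c * l u + l v.
Hypothesis rP : forall c u v, r (c *: u + v) = c * r u + r v.

Definition glued_fun (u v : U) : R := - g (f u) (f v) + l u * r v + l v * r u.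

Lemma glued_fun_is_bilinear : bilinear_for
  (GRing.Scale.Law.clone _ _ *%R _) (GRing.Scale.Law.clone _ _ *%R _) glued_fun.
Proof.
split=> [w|w] c u v; rewrite /glued_fun !fP !lP !rP /=.
  by rewrite sfDl sfZl; ring.
by rewrite sfDr sfZr; ring.
Qed.

Lemma glued_fun_sym x y : glued_fun x y = (-1) ^+ false * idfun (glued_fun y x).
Proof. by rewrite mul1r /glued_fun sfC /= addrAC. Qed.

HB.instance Definition _ := bilinear_isBilinear.Build R U U R _ (idfun \; *%R)
  glued_fun glued_fun_is_bilinear.
HB.instance Definition _ :=
  isHermitianSesquilinear.Build R U false idfun glued_fun glued_fun_sym.

Definition glued_form : {symmetric U} := glued_fun.

End GluedForm.

Section QuadraticFunctions.
Context {R : realType} {V : vectType R}.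
Variable A : affineType V.

Definition is_quadratic (d : A -> R^o) : Prop :=
  forall (a b : R) (P Q : A), a + b = 1 ->
    d (comb a b P Q) = a * (a - b) * d P + b * (b - a) * d Q
                       + 4 * a * b * d (comb 2^-1 2^-1 P Q).

Definition quadratic_pred : {pred A -> R^o} := fun d => `[< is_quadratic d >].

Lemma quadratic_predP d : reflect (is_quadratic d) (d \in quadratic_pred).
Proof. exact: asboolP. Qed.

Lemma quadratic_submod_closed : submod_closed quadratic_pred.
Proof.
split; first by apply/quadratic_predP => a b P Q _; rewrite !mulr0 !addr0.
move=> c f g /quadratic_predP Hf /quadratic_predP Hg; apply/quadratic_predP.
move=> a b P Q ab; rewrite addrfctE scalrfctE (Hf _ _ _ _ ab) (Hg _ _ _ _ ab).
by rewrite /GRing.scale /=; ring.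
Qed.

HB.instance Definition _ :=
  GRing.isSubmodClosed.Build R (A -> R^o) quadratic_pred quadratic_submod_closed.

Record Quad :=
  MkQuad { quad_fun :> A -> R^o; quad_funP : quad_fun \in quadratic_pred }.

HB.instance Definition _ := [isSub for quad_fun].
HB.instance Definition _ := [Choice of Quad by <:].
HB.instance Definition _ := [SubChoice_isSubLmodule of Quad by <:].

Lemma QuadE (d : Quad) : is_quadratic d.
Proof. exact/quadratic_predP/quad_funP. Qed.

Lemma QuadP (d e : Quad) : d =1 e -> d = e.
Proof. by move=> de; apply/val_inj/funext. Qed.

Lemma addQuadE (d e : Quad) P : (d + e) P = d P + e P.
Proof. by []. Qed.
Lemma subQuadE (d e : Quad) P : (d - e) P = d P - e P.
Proof. by []. Qed.
Lemma scaleQuadE c (d : Quad) P : (c *: d) P = c * d P.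
Proof. by []. Qed.

Lemma affine_quadratic (f : A -> R^o) : is_affine f -> is_quadratic f.
Proof.
have h : 2^-1 + 2^-1 = 1 :> R by field.
move=> Hf a b P Q ab; rewrite !Hf //.
by have -> : a = 1 - b by [rewrite -ab addrK]; field.
Qed.

Definition affine_quad_pred : {pred Quad} :=
  fun d : Quad => `[< is_affine d >].

Lemma affine_quad_predP (d : Quad) : reflect (is_affine d) (d \in affine_quad_pred).
Proof. exact: asboolP. Qed.

Lemma affine_quad_submod_closed : submod_closed affine_quad_pred.
Proof.
split; first by apply/affine_quad_predP => a b P Q _; rewrite !mulr0 addr0.
move=> c f g /affine_quad_predP Hf /affine_quad_predP Hg.
apply/affine_quad_predP => a b P Q ab.
rewrite !addQuadE !scaleQuadE (Hf _ _ _ _ ab) (Hg _ _ _ _ ab); ring.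
Qed.

HB.instance Definition _ :=
  GRing.isSubmodClosed.Build R Quad affine_quad_pred affine_quad_submod_closed.

(* Quad A / Aff A *)
Definition Met := Quotient.quot affine_quad_pred.

End QuadraticFunctions.

Section Hessian.
Context {R : realType} {V : vectType R} {A : affineType V}.

Section Plane.
Variable F : R -> R -> R.
Hypothesis HF : forall a b s1 t1 s2 t2, a + b = 1 ->
  F (a * s1 + b * s2) (a * t1 + b * t2) =
    a * (a - b) * F s1 t1 + b * (b - a) * F s2 t2
    + 4 * a * b * F (2^-1 * s1 + 2^-1 * s2) (2^-1 * t1 + 2^-1 * t2).

Lemma lineF s1 t1 s2 t2 s3 t3 c s t :
  s1 + s3 = 2 * s2 -> t1 + t3 = 2 * t2 ->
  s = s2 + c * (s3 - s2) -> t = t2 + c * (t3 - t2) ->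
  F s t = c * (c - 1) / 2 * F s1 t1 + (1 - c ^+ 2) * F s2 t2
          + c * (c + 1) / 2 * F s3 t3.
Proof.
move=> hs ht -> ->.
have h : (1 - c) / 2 + (1 + c) / 2 = 1 by field.
have := HF s1 t1 s3 t3 h.
have -> : (1 - c) / 2 * s1 + (1 + c) / 2 * s3 = s2 + c * (s3 - s2).
  have -> : s1 = 2 * s2 - s3 by rewrite -hs addrK.
  by field.
have -> : (1 - c) / 2 * t1 + (1 + c) / 2 * t3 = t2 + c * (t3 - t2).
  have -> : t1 = 2 * t2 - t3 by rewrite -ht addrK.
  by field.
rewrite -!mulrDr hs ht !mulKf ?pnatr_eq0 // => ->.
by field.
Qed.

Let interp s t : F s t =
  s * (s - 1) / 2 *
    (t * (t - 1) / 2 * F (-1) (-1) + (1 - t ^+ 2) * F (-1) 0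
      + t * (t + 1) / 2 * F (-1) 1) +
  (1 - s ^+ 2) *
    (t * (t - 1) / 2 * F 0 (-1) + (1 - t ^+ 2) * F 0 0
      + t * (t + 1) / 2 * F 0 1) +
  s * (s + 1) / 2 *
    (t * (t - 1) / 2 * F 1 (-1) + (1 - t ^+ 2) * F 1 0
      + t * (t + 1) / 2 * F 1 1).
Proof.
rewrite (@lineF (-1) t 0 t 1 t s s t); [|ring..].
rewrite (@lineF (-1) (-1) (-1) 0 (-1) 1 t (-1) t); [|ring..].
rewrite (@lineF 0 (-1) 0 0 0 1 t 0 t); [|ring..].
rewrite (@lineF 1 (-1) 1 0 1 1 t 1 t); [by []|ring..].
Qed.

Lemma quadratic_plane s t : F s t =
  F 0 0 + s * ((F 1 0 - F (-1) 0) / 2) + t * ((F 0 1 - F 0 (-1)) / 2)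
  + s ^+ 2 * ((F 1 0 + F (-1) 0 - 2 * F 0 0) / 2)
  + t ^+ 2 * ((F 0 1 + F 0 (-1) - 2 * F 0 0) / 2)
  + s * t * (F 1 1 - F 1 0 - F 0 1 + F 0 0).
Proof.
have := interp 2 2; rewrite (@lineF (-1) (-1) 0 0 1 1 2 2 2); [|ring..].
have := interp (-2) (-2); rewrite (@lineF (-1) (-1) 0 0 1 1 (-2) (-2) (-2)); [|ring..].
have := interp 2 (-2); rewrite (@lineF (-1) 1 0 0 1 (-1) 2 2 (-2)); [|ring..].
rewrite (interp s t).
move: (F 1 1) (F 1 0) (F 1 (-1)) (F 0 1) (F 0 0) (F 0 (-1))
  (F (-1) 1) (F (-1) 0) (F (-1) (-1)).
move=> f1 f2 f3 f4 f5 f6 f7 f8 f9 h1 h2 h3.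
have -> : f9 = f8 + f6 + f1 - f2 - f4 by lra.
have -> : f3 = 2 * f2 + f4 + f6 - 2 * f5 - f1 by lra.
have -> : f7 = f2 + 2 * f4 + f8 - 2 * f5 - f1 by lra.
by field.
Qed.

End Plane.

Section HessianFunction.
Variable d : Quad A.

Definition hess_at (P : A) (x y : V) : R :=
  d (P +v (x + y)) - d (P +v x) - d (P +v y) + d P.

Let D P x : R := d (P +v x) + d (P +v (- x)) - 2 * d P.

Lemma quad_plane P x y s t : d (P +v (s *: x + t *: y)) =
  d P + s * ((d (P +v x) - d (P +v (- x))) / 2)
  + t * ((d (P +v y) - d (P +v (- y))) / 2)
  + s ^+ 2 * (D P x / 2) + t ^+ 2 * (D P y / 2) + s * t * hess_at P x y :> R.
Proof.
pose F s t : R := d (P +v (s *: x + t *: y)).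
have HF a b s1 t1 s2 t2 : a + b = 1 ->
  F (a * s1 + b * s2) (a * t1 + b * t2) =
    a * (a - b) * F s1 t1 + b * (b - a) * F s2 t2
    + 4 * a * b * F (2^-1 * s1 + 2^-1 * s2) (2^-1 * t1 + 2^-1 * t2).
  move=> ab; have h : 2^-1 + 2^-1 = 1 :> R by field.
  have := QuadE d (P +v (s1 *: x + t1 *: y)) (P +v (s2 *: x + t2 *: y)) ab.
  rewrite !comb_translate // /F => E.
  have sc (u v : R) : u *: (s1 *: x + t1 *: y) + v *: (s2 *: x + t2 *: y)
      = (u * s1 + v * s2) *: x + (u * t1 + v * t2) *: y.
    by rewrite !scalerDr !scalerA addrACA -!scalerDl.
  by rewrite !sc in E.
have := quadratic_plane HF s t; rewrite /F !scaleN1r !scale1r !scale0r.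
by rewrite !addr0 !add0r translate0 /D /hess_at => ->; field.
Qed.

Let D_base P x z : D (P +v z) x = D P x.
Proof.
have h1 := quad_plane P x z 1 1; have h2 := quad_plane P x z (-1) 1.
rewrite !scale1r scaleN1r in h1 h2; rewrite /D !translateA (addrC z) (addrC z).
by rewrite h1 h2 /D /hess_at; field.
Qed.

Let hess_D P x y : hess_at P x y = (D P (x + y) - D P (x - y)) / 4.
Proof.
have h1 := quad_plane P x y 1 1; have h2 := quad_plane P x y (-1) 1.
have h3 := quad_plane P x y 1 (-1); have h4 := quad_plane P x y (-1) (-1).
rewrite !(scale1r, scaleN1r) in h1 h2 h3 h4.
rewrite {1 2}/D !opprD opprK h1 h2 h3 h4 /D.
by field.
Qed.

Lemma hess_at_base P Q x y : hess_at Q x y = hess_at P x y.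
Proof. by rewrite -(vectK P Q) !hess_D !D_base. Qed.

Let hess_atDr P x y z : hess_at P x (y + z) = hess_at P x y + hess_at P x z.
Proof.
rewrite -(hess_at_base P (P +v z) x y) /hess_at !translateA.
have -> : z + (x + y) = x + (y + z) by rewrite addrCA (addrC z).
by rewrite (addrC z x) (addrC z y); ring.
Qed.

Let hess_atZr P x c y : hess_at P x (c *: y) = c * hess_at P x y.
Proof.
have h1 := quad_plane P x y 1 c; have h2 := quad_plane P x y 0 c.
rewrite scale1r in h1; rewrite scale0r add0r in h2.
by rewrite {1}/hess_at h1 h2 /D; field.
Qed.

Let hess_atC P x y : hess_at P x y = hess_at P y x.
Proof. by rewrite /hess_at (addrC x y); ring. Qed.

Definition hess_fun (x y : V) : R := hess_at origin x y.

Lemma hess_fun_is_bilinear : bilinear_for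
  (GRing.Scale.Law.clone _ _ *%R _) (GRing.Scale.Law.clone _ _ *%R _) hess_fun.
Proof.
split=> [y|x] c u v; rewrite /hess_fun.
  by rewrite !(hess_atC _ _ y) hess_atDr hess_atZr.
by rewrite hess_atDr hess_atZr.
Qed.

Lemma hess_fun_sym x y : hess_fun x y = (-1) ^+ false * idfun (hess_fun y x).
Proof. by rewrite mul1r /hess_fun hess_atC. Qed.

HB.instance Definition _ := bilinear_isBilinear.Build R V V R _ (idfun \; *%R)
  hess_fun hess_fun_is_bilinear.
HB.instance Definition _ :=
  isHermitianSesquilinear.Build R V false idfun hess_fun hess_fun_sym.

Definition is_hess (g : {symmetric V}) : Prop := forall P Q : A,
  2^-1 * (d Q + d (comb 2 (-1) P Q)) - d P
  = 2^-1 * g (vect P Q) (vect P Q) :> R.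

Lemma hess_fun_is_hess : is_hess hess_fun.
Proof.
move=> P Q; set x := vect P Q.
rewrite /= /hess_fun (hess_at_base P) hess_D subrr {1 2}/D opprD.
rewrite /comb scaleN1r -{1}(vectK P Q) -/x.
have := quad_plane P x 0 2 0; rewrite scaler0 addr0 scaler_nat mulr2n => ->.
have := quad_plane P x 0 (-2) 0; rewrite scaler0 addr0.
by rewrite scaleNr scaler_nat mulr2n opprD /D oppr0 translate0 => ->; field.
Qed.

Lemma hess_exists : exists g, is_hess g.
Proof. by exists hess_fun; exact: hess_fun_is_hess. Qed.

Definition hess : {symmetric V} := sval (cid hess_exists).

Lemma hessP : is_hess hess.
Proof. exact: svalP (cid hess_exists). Qed.

End HessianFunction.

Lemma hess_unique d (g g' : {symmetric V}) :
  is_hess d g -> is_hess d g' -> g =2 g'.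
Proof.
move=> hg hg'.
have diag x : g x x = g' x x.
  have /(_ (origin : A) (origin +v x)) := hg.
  have /(_ (origin : A) (origin +v x)) -> := hg'.
  by rewrite !translateK => /(mulfI _) ->; rewrite // invr_neq0 ?pnatr_eq0.
move=> x y; have := diag (x + y); rewrite !sfDl !sfDr !diag.
by rewrite (sfC g y x) (sfC g' y x); lra.
Qed.

Lemma hess_expand (d : Quad A) (P : A) x y :
  hess d x y = d (P +v (x + y)) - d (P +v x) - d (P +v y) + d P :> R.
Proof.
rewrite (hess_unique (hessP d) (@hess_fun_is_hess d)) /= /hess_fun.
exact: hess_at_base.
Qed.

Lemma hessB (d e : Quad A) x y : hess (d - e) x y = hess d x y - hess e x y.
Proof. by rewrite !(hess_expand _ origin) !subQuadE; ring. Qed.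

Lemma quad_taylor (d : Quad A) (P : A) x y a b :
  d (P +v (a *: x + b *: y)) =
  d P + a * ((d (P +v x) - d (P +v (- x))) / 2)
  + b * ((d (P +v y) - d (P +v (- y))) / 2)
  + hess d (a *: x + b *: y) (a *: x + b *: y) / 2 :> R.
Proof.
have diag z : d (P +v z) + d (P +v (- z)) - 2 * d P = hess d z z.
  rewrite -[hess d z z]opprK -sfNr (hess_expand _ P) subrr translate0; ring.
rewrite quad_plane !diag sfDl !sfDr !sfZl !sfZr.
rewrite (sfC _ y x).
have -> : hess_at d P x y = hess d x y by rewrite (hess_expand _ P).
by field.
Qed.

Lemma hess_affine (d : Quad A) : is_affine d <-> hess d =2 (fun _ _ => 0).
Proof.
split=> [Hd x y|d0 a b P Q ab].
  by rewrite (hess_expand _ origin) affine_translateD //; ring.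
pose x := vect P Q; have -> : Q = P +v x by rewrite vectK.
rewrite -{1}(translate0 P) comb_translate // quad_taylor d0 oppr0 translate0 subrr.
have := quad_taylor d P 0 x 0 1.
rewrite d0 scale0r scale1r add0r oppr0 translate0 subrr => h.
have -> : d (P +v (- x)) = 2 * d P - d (P +v x) :> R by move: h; lra.
have -> : a = 1 - b by rewrite -ab addrK.
by field.
Qed.

Lemma dist_is_quadratic (g : {symmetric V}) (P : A) :
  is_quadratic (fun Q => 2^-1 * g (vect P Q) (vect P Q) : R^o).
Proof.
move=> a b Q S ab; have h : 2^-1 + 2^-1 = 1 :> R by field.
rewrite -(vectK P Q) -(vectK P S); move: (vect P Q) (vect P S) => x y.
rewrite !comb_translate // !translateK.
rewrite !sfDl !sfDr !sfZl !sfZr (sfC g y x).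
by have -> : a = 1 - b by [rewrite -ab addrK]; field.
Qed.

Definition half_square (g : {symmetric V}) (P : A) : Quad A :=
  MkQuad (introT (quadratic_predP _) (dist_is_quadratic g P)).

Lemma hess_half_square g (P : A) : hess (half_square g P) =2 g.
Proof.
move=> x y; rewrite (hess_expand _ P) /= !translateK.
have -> : vect P P = 0 by apply: (@translateI _ _ _ P); rewrite vectK translate0.
by rewrite !sfDl !sfDr !sf0l (sfC g y x); field.
Qed.

End Hessian.

Section LinearHull.
Context {R : realType} {V : vectType R} {A : affineType V}.

Lemma linpart_is_linear : linear (@linpart R V A).
Proof.
move=> c f g; apply/lfunP => x; rewrite add_lfunE scale_lfunE.
by rewrite !(linpartE _ origin) !addAffE !scaleAffE /GRing.scale /=; ring.
Qed.
HB.instance Definition _ := GRing.isLinear.Build R (Aff A) 'Hom(V, R^o) _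
  (@linpart R V A) linpart_is_linear.

(* Linear hull: the dual of Aff B; points and vectors of B embed in it by
   point_hull and vector_hull. *)
Definition Hull (B : affineType V) := 'Hom(Aff B, R^o).

Definition eval_fun (P : A) (s : Aff A) : R^o := s P.
Lemma eval_fun_is_linear P : linear (eval_fun P). Proof. by []. Qed.
HB.instance Definition _ P := GRing.isLinear.Build R (Aff A) R^o _
  (eval_fun P) (eval_fun_is_linear P).

Definition point_hull (P : A) : Hull A := linfun (eval_fun P).

Lemma point_hullE P s : point_hull P s = s P.
Proof. exact: lfunE. Qed.

Definition vector_hull (x : V) : Hull A :=
  point_hull (origin +v x) - point_hull origin.

Lemma vector_hullE x s : vector_hull x s = linpart s x.
Proof. by rewrite add_lfunE opp_lfunE !point_hullE (linpartE _ origin). Qed.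

Lemma vector_hull_vect P Q :
  vector_hull (vect P Q) = point_hull Q - point_hull P.
Proof.
apply/lfunP => s; rewrite vector_hullE add_lfunE opp_lfunE !point_hullE.
by rewrite (linpartE _ P) vectK.
Qed.

Lemma const_is_affine (c : R) : is_affine (fun _ : A => c : R^o).
Proof. by move=> a b P Q ab; rewrite -mulrDl ab mul1r. Qed.

Definition unit_aff : Aff A :=
  MkAff (introT (affine_predP _) (const_is_affine 1)).

Lemma sumAffE I (r : seq I) (F : I -> Aff A) P :
  (\sum_(i <- r) F i) P = \sum_(i <- r) F i P.
Proof. exact: (linear_sum (eval_fun P)). Qed.

Let n := \dim (fullv : {vspace V}).
Let e : n.-tuple V := vbasis fullv.

Definition hull_vector (z : Hull A) : V :=
  \sum_(i < n) z (mkaff (coord e i) 0 origin) *: e`_i.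

Lemma hull_vector_is_linear : linear hull_vector.
Proof.
move=> c y z; rewrite /hull_vector scaler_sumr -big_split /=.
apply: eq_bigr => i _.
by rewrite add_lfunE scale_lfunE scalerDl scalerA.
Qed.
HB.instance Definition _ := GRing.isLinear.Build R (Hull A) V _
  hull_vector hull_vector_is_linear.

Lemma vector_hullK : cancel vector_hull hull_vector.
Proof.
move=> x; rewrite /hull_vector [RHS](coord_vbasis (memvf x)).
apply: eq_bigr => i _; congr (_ *: _); rewrite vector_hullE (linpartE _ origin).
by rewrite /= translateK (_ : vect origin origin = 0) ?linear0 ?addr0 ?subr0 //
  -(@vectB _ _ A origin) subrr.
Qed.

(* vector_hull identifies V with {z : <z, u> = 0} *)
Lemma hull_vectorK (z : Hull A) :
  z unit_aff = 0 -> vector_hull (hull_vector z) = z.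
Proof.
move=> z0; apply/lfunP => s; rewrite vector_hullE.
have {2}-> : s = s origin *: unit_aff
   + \sum_(i < n) linpart s e`_i *: mkaff (coord e i) 0 origin.
  apply: AffP => Q; rewrite addAffE scaleAffE mulr1 sumAffE.
  have -> : s Q = s origin + linpart s (vect origin Q).
    by rewrite (linpartE _ origin) vectK addrC subrK.
  congr (_ + _).
  rewrite {1}(coord_vbasis (memvf (vect origin Q))) linear_sum /=.
  by apply: eq_bigr => i _; rewrite linearZ /= /GRing.scale /= addr0 mulrC.
rewrite linearD linearZ /= z0 scaler0 add0r /hull_vector !linear_sum.
by apply: eq_bigr => i _; rewrite !linearZ /= /GRing.scale /= mulrC.
Qed.

End LinearHull.

Section Metric.
Context {R : realType} {V : vectType R} {A : affineType V}.

Definition aff_quad (s : Aff A) : Quad A :=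
  MkQuad (introT (quadratic_predP _) (affine_quadratic (AffE s))).

Variable m : Met A.

(* The class m, made below an affine space directed by Aff A *)
Record QuadM := MkQuadM
  { quadM_val :> Quad A; quadM_valP : \pi_(Met A)%qT quadM_val == m }.

HB.instance Definition _ := [isSub for quadM_val].
HB.instance Definition _ := [Choice of QuadM by <:].

Lemma same_class (d e : Quad A) :
  is_affine (d - e) <-> \pi_(Met A)%qT d = \pi_(Met A)%qT e.
Proof.
split=> [h|/eqP].
  by apply/eqP; rewrite -Quotient.idealrBE; apply/affine_quad_predP.
by rewrite -Quotient.idealrBE => /affine_quad_predP.
Qed.

Lemma quadM_translate_subproof (d : QuadM) (s : Aff A) :
  \pi_(Met A)%qT (quadM_val d + aff_quad s) == m.
Proof.
rewrite -(eqP (quadM_valP d)); apply/eqP/same_class.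
by rewrite addrAC subrr add0r; exact: AffE.
Qed.

Definition quadM_translate (d : QuadM) (s : Aff A) : QuadM :=
  MkQuadM (quadM_translate_subproof d s).

Lemma quadM_vect_subproof (d e : QuadM) :
  is_affine (quadM_val e - quadM_val d).
Proof. by apply/same_class; rewrite (eqP (quadM_valP d)) (eqP (quadM_valP e)). Qed.

Definition quadM_vect (d e : QuadM) : Aff A :=
  MkAff (introT (affine_predP _) (quadM_vect_subproof d e)).

Lemma quadM_translateK d s : quadM_vect d (quadM_translate d s) = s.
Proof. by apply: AffP => P; rewrite /= addrC addKr. Qed.

Lemma quadM_vectK d e : quadM_translate d (quadM_vect d e) = e.
Proof. by apply/val_inj/QuadP => P; rewrite /= addrC subrK. Qed.

Lemma quadM_translateA d s t :
  quadM_translate (quadM_translate d s) t = quadM_translate d (s + t).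
Proof.
by apply/val_inj/QuadP => P; rewrite /= addrA.
Qed.

Lemma quadM_inhabited : inhabited QuadM.
Proof.
by constructor; apply: (@MkQuadM (repr m)); rewrite reprK.
Qed.

HB.instance Definition _ := isAffine.Build R (Aff A) QuadM
  quadM_translateK quadM_vectK quadM_translateA quadM_inhabited.

Lemma quadM_translateE (d : QuadM) (s : Aff A) P : (d +v s) P = d P + s P.
Proof. by []. Qed.

Definition hessM : {symmetric V} := hess (repr m).

Lemma hessM_class (d : QuadM) : hess d =2 hessM.
Proof.
move=> x y; apply/eqP; rewrite -subr_eq0 -hessB; apply/eqP.
by apply/hess_affine: x y; apply/same_class; rewrite reprK (eqP (quadM_valP d)).
Qed.

Lemma deltaM_subproof (P : A) : \pi_(Met A)%qT (half_square hessM P) == m.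
Proof.
rewrite -[X in _ == X]reprK; apply/eqP/same_class/hess_affine => x y.
by rewrite hessB hess_half_square subrr.
Qed.

Definition deltaM (P : A) : QuadM := MkQuadM (deltaM_subproof P).

Definition value_fun (P : A) (d : QuadM) : R^o := d P.

Lemma value_fun_is_affine P : is_affine (value_fun P).
Proof.
move=> a b d e ab; rewrite /value_fun /comb quadM_translateE scaleAffE /=.
rewrite -[LHS]/(d P + b * (e P - d P) : R).
by have -> : a = 1 - b by [rewrite -ab addrK]; ring.
Qed.

Definition value (P : A) : Aff QuadM :=
  MkAff (introT (affine_predP _) (value_fun_is_affine P)).

Definition d_m (v : Aff QuadM) : Hull A := linpart v.

Definition Aff0 (v : Aff QuadM) : Prop :=
  forall (d : QuadM) (c : R), v (d +v (c *: unit_aff)) = v d.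

(* In the first condition d_m v1 and d_m v2 are the vectors x1 and x2, seen in the
   linear hull; these vectors exist and are unique by Aff0P, hull_vectorK and
   vector_hullK. *)
Definition is_CM (B : {symmetric (Aff QuadM)}) : Prop :=
  (forall (v1 v2 : Aff QuadM) (x1 x2 : V), Aff0 v1 -> Aff0 v2 ->
     d_m v1 = vector_hull x1 -> d_m v2 = vector_hull x2 ->
     B v1 v2 = - hessM x1 x2) /\
  (forall P : A, linfun (B (value P) : _ -> R^o) = point_hull (deltaM P)).

Lemma is_CM_value (B : {symmetric (Aff QuadM)}) : is_CM B ->
  forall P w, B (value P) w = w (deltaM P).
Proof. by move=> [_ H] P w; rewrite -point_hullE -H lfunE. Qed.

(* v = red v + lam v v_O, with red v in Aff0 *)
Let lam (v : Aff QuadM) : R := d_m v unit_aff.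
Let red (v : Aff QuadM) : Aff QuadM := v - lam v *: value origin.

Let lam_is_linear c v w : lam (c *: v + w) = c * lam v + lam w.
Proof. by rewrite /lam /d_m linearP add_lfunE scale_lfunE. Qed.

Let redP c v w : red (c *: v + w) = c *: red v + red w.
Proof.
rewrite /red lam_is_linear scalerDl opprD scalerBr scalerA.
by rewrite addrACA.
Qed.

Let value_lin P (s : Aff A) : d_m (value P) s = s P.
Proof.
by rewrite /d_m (linpartE _ (deltaM P)) /= /value_fun quadM_translateE addrC addKr.
Qed.

Let lam_red v : d_m (red v) unit_aff = 0.
Proof.
rewrite /d_m linearB linearZ /= add_lfunE opp_lfunE scale_lfunE value_lin.
by rewrite /= -/(d_m v) -/(lam v) /GRing.scale /= mulr1 subrr.
Qed.

Lemma Aff0P v : Aff0 v <-> d_m v unit_aff = 0.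
Proof.
split=> [v0|v0 d c].
  rewrite /d_m (linpartE _ (deltaM origin)).
  by have := v0 (deltaM origin) 1; rewrite scale1r => ->; rewrite subrr.
have := linpartE v d (c *: unit_aff); rewrite linearZ /= -/(d_m v) v0 scaler0.
by move/eqP; rewrite eq_sym subr_eq0 => /eqP.
Qed.

Let vec (v : Aff QuadM) : V := hull_vector (d_m (red v)).

Let vecP c v w : vec (c *: v + w) = c *: vec v + vec w.
Proof. by rewrite /vec redP /d_m linpart_is_linear hull_vector_is_linear. Qed.

Let d0 : QuadM := deltaM origin.

Let redPE c v w : red (c *: v + w) d0 = c * red v d0 + red w d0.
Proof. by rewrite redP. Qed.

Definition CM_fun : {symmetric (Aff QuadM)} :=
  glued_form hessM vecP lam_is_linear redPE.

Lemma CM_funE v w : CM_fun v w =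
  - hessM (vec v) (vec w) + lam v * red w d0 + lam w * red v d0.
Proof. by []. Qed.

Lemma CM_fun_is_CM : is_CM CM_fun.
Proof.
split=> [v1 v2 x1 x2 /Aff0P h1 /Aff0P h2 e1 e2|P].
  rewrite CM_funE /vec /red /lam h1 h2 !scale0r !subr0 !mul0r !addr0.
  by rewrite e1 e2 !vector_hullK.
apply/lfunP => w; rewrite lfunE point_hullE /= CM_funE.
have -> : lam (value P) = 1 by rewrite /lam value_lin.
set x := vect origin P.
have e1 : d_m (red (value P)) = vector_hull x.
  apply/lfunP => s; rewrite /red /d_m linearB linearZ /= add_lfunE opp_lfunE.
  rewrite scale_lfunE !value_lin vector_hullE (linpartE _ origin) vectK.
  by rewrite /lam value_lin scale1r.
have -> : vec (value P) = x by rewrite /vec e1 vector_hullK.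
have -> : red (value P) d0 = 2^-1 * hessM x x :> R.
  rewrite subAffE scaleAffE /lam value_lin /= /value_fun /= -/x.
  rewrite (_ : vect origin origin = 0) ?sf0l ?mulr0 ?subr0 //.
  by rewrite -(@vectB _ _ A origin) subrr.
have -> : w (deltaM P) = red w (deltaM P) + lam w * (2^-1 * hessM x x) :> R.
  rewrite subAffE scaleAffE /= /value_fun /=.
  have -> : vect P origin = - x by rewrite vectN.
  by rewrite sfNr (sfC _ (- x)) sfNr opprK subrK.
rewrite mul1r; congr (_ + _).
have e2 := linpartE (red w) d0 (vect d0 (deltaM P)).
rewrite vectK in e2.
suff H : linpart (red w) (vect d0 (deltaM P)) = - hessM x (vec w) :> R.
  by rewrite -H e2 subrK.
rewrite -/(d_m _) -(hull_vectorK (lam_red w)) -/(vec w) vector_hullE.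
rewrite (linpartE _ P) /=; move: (vec w) => y.
pose h (S Q : A) := 2^-1 * hessM (vect S Q) (vect S Q) : R.
rewrite -[LHS]/(h P (P +v y) - h origin (P +v y) - (h P P - h origin P)) /h.
have -> : vect origin (P +v y) = x + y.
  by rewrite -[P in LHS](vectK origin) translateA translateK.
have -> : vect P P = 0 by rewrite -(vectB origin) subrr.
rewrite translateK -/x sfDl !sfDr (sfC _ y x) sf0l.
by field.
Qed.

Lemma CM_exists : exists B, is_CM B.
Proof. by exists CM_fun; exact: CM_fun_is_CM. Qed.

Lemma CM_unique (B B' : {symmetric (Aff QuadM)}) :
  is_CM B -> is_CM B' -> B =2 B'.
Proof.
move=> hB hB' v w.
have dec u : u = red u + lam u *: value origin by rewrite /red subrK.
have dv u : d_m (red u) = vector_hull (vec u).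
  by rewrite /vec hull_vectorK // lam_red.
have r0 u : Aff0 (red u) by apply/Aff0P/lam_red.
have E : B (red v) (red w) = B' (red v) (red w).
  by rewrite (hB.1 _ _ _ _ (r0 v) (r0 w) (dv v) (dv w))
             (hB'.1 _ _ _ _ (r0 v) (r0 w) (dv v) (dv w)).
rewrite (dec v) (dec w); move: (red v) (red w) (lam v) (lam w) E => r t b c E.
rewrite !sfDl !sfZl !sfDr !sfZr E !is_CM_value //.
by rewrite !(sfC _ r (value _)) !is_CM_value.
Qed.

Definition CM : {symmetric (Aff QuadM)} := sval (cid CM_exists).

Lemma CM_is_CM : is_CM CM.
Proof. exact: svalP (cid CM_exists). Qed.

End Metric.

(* Main.v *)
Require Import Defs.
From mathcomp Require Import all_boot all_order all_algebra.
From mathcomp Require Import sesquilinear reals.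

Import GRing.Theory.
Local Open Scope ring_scope.

(** Write [g] for the hessian [hessM m] of the metric. The form is
    non-degenerate because a functional [v] in its radical can be taken apart by
    pairing it with three kinds of test functionals.

    - Against the constant functional 1, the form returns the slope of [v]
      along the constant functions (lemma [CM_unit]): 1 pairs to 1 with every
      evaluation, and to 0 with [Aff0], since its own linear part is zero.
      Hence [v] lies in [Aff0], and its linear part is a vector [x] of [V].
    - Against the difference of the evaluations at [P] and [P +v y], which lies
      in [Aff0] and has linear part [y], it returns [- g x y] (lemma
      [CM_value_sub]). All vectors [y] occur, so non-degeneracy of [g] gives
      [x = 0], and [v] is constant.
    - Against the evaluation at [P], it returns the value of [v] at [deltaM P].
      So this constant is zero.

    The first test is what makes the argument uniform in the dimension: the
    functions [deltaM P] affinely span the class [m] only when [V] is nonzero,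
    so the evaluations alone do not detect the radical over a point. *)

Section CayleyMenger.
Context {R : realType} {V : vectType R} {A : affineType V}.
Variable m : Met A.
Implicit Types (v : Aff (QuadM m)) (P : A) (x y : V) (s : Aff A).

Lemma d_m_value P s : d_m (value m P) s = s P.
Proof.
rewrite /d_m (linpartE _ (deltaM m P)) /= /value_fun quadM_translateE.
by rewrite addrC addKr.
Qed.

Lemma d_m_unit : d_m (unit_aff : Aff (QuadM m)) = 0.
Proof.
by apply/lfunP => s; rewrite /d_m (linpartE _ origin) /= subrr lfunE.
Qed.

Lemma d_m_value_sub P y :
  d_m (value m (P +v y) - value m P) = vector_hull y.
Proof.
apply/lfunP => s; rewrite vector_hullE (linpartE _ P) /d_m linearB /=.
by rewrite add_lfunE opp_lfunE -!/(d_m _) !d_m_value.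
Qed.

Lemma Aff0_hull_vector v :
  Aff0 v -> d_m v = vector_hull (hull_vector (d_m v)).
Proof. by move=> /Aff0P v0; rewrite hull_vectorK. Qed.

Lemma Aff0_const v P : d_m v = 0 -> v = v (deltaM m P) *: unit_aff.
Proof.
move=> dv0; apply: AffP => d; rewrite scaleAffE mulr1.
have := linpartE v (deltaM m P) (vect (deltaM m P) d).
by rewrite vectK -/(d_m v) dv0 lfunE => /esym/eqP; rewrite subr_eq0 => /eqP.
Qed.

(** The constant functional 1 is represented by the slope along the constant
    functions: [v] minus that slope times an evaluation lies in [Aff0], where
    the pairing with 1 is given by [hessM m] against the zero vector. *)
Lemma CM_unit v : CM m v unit_aff = d_m v unit_aff.
Proof.
have [CM0 _] := CM_is_CM m.
set c := d_m v unit_aff; pose r := v - c *: value m origin.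
have r0 : Aff0 r.
  apply/Aff0P; rewrite /d_m linearB linearZ /= add_lfunE opp_lfunE scale_lfunE.
  by rewrite -!/(d_m _) d_m_value -/c /GRing.scale /= mulr1 subrr.
have u0 : Aff0 (unit_aff : Aff (QuadM m)).
  by apply/Aff0P; rewrite d_m_unit lfunE.
have du : d_m (unit_aff : Aff (QuadM m)) = vector_hull (0 : V).
  by rewrite d_m_unit; apply/lfunP => s; rewrite vector_hullE linear0 lfunE.
have -> : v = r + c *: value m origin by rewrite subrK.
rewrite sfDl sfZl (CM0 _ _ _ _ r0 u0 (Aff0_hull_vector _ r0) du).
by rewrite linear0r oppr0 add0r (is_CM_value (CM_is_CM m)) /= mulr1.
Qed.

Lemma CM_value_sub v P x y : Aff0 v -> d_m v = vector_hull x ->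
  CM m v (value m (P +v y) - value m P) = - hessM m x y.
Proof.
move=> v0 dv; have [CM0 _] := CM_is_CM m.
apply: CM0 => //; last exact: d_m_value_sub.
by apply/Aff0P; rewrite d_m_value_sub vector_hullE (linpartE _ P) subrr.
Qed.

End CayleyMenger.

Theorem corollary5p21 (R : realType) (V : vectType R) (A : affineType V)
    (m : Met A) :
  nondegenerate (hessM m) -> nondegenerate (CM m).
Proof.
move=> /nondegenerateP gnd; apply/nondegenerateP => v vrad.
have v0 : Aff0 v by apply/Aff0P; rewrite -CM_unit vrad.
have dv := Aff0_hull_vector _ _ v0.
have x0 : hull_vector (d_m v) = 0.
  apply: gnd => y; apply: oppr_inj.
  by rewrite -(CM_value_sub _ _ origin _ _ v0 dv) vrad oppr0.
have dv0 : d_m v = 0.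
  by rewrite dv x0; apply/lfunP => s; rewrite vector_hullE linear0 lfunE.
rewrite (Aff0_const _ _ origin dv0) -(is_CM_value (CM_is_CM m)) sfC vrad.
by rewrite scale0r.
Qed.
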